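(* Let $\ell,m\ge 3$ be integers with $(\ell-2)(m-2)>4$, and let $D_{\ell,m}(X)\in\mathbb Z[X]$ be the polynomial defined as follows. If $m=2w$ is even, $$D_{\ell,m}(X)=1-(\ell-2)X-(\ell-2)X^2-\dots-(\ell-2)X^{w-1}+X^{w};$$ if $m=2w+1$ is odd, $$D_{\ell,m}(X)=1-(\ell-2)X-\dots-(\ell-2)X^{w-1}-(\ell-4)X^{w}-(\ell-2)X^{w+1}-\dots-(\ell-2)X^{2w-1}+X^{2w}.$$ Then $D_{\ell,m}$ is a reciprocal Salem polynomial. Moreover, let $E_{\ell,m}=D_{\ell,m}/(X+1)$ if $m\equiv 2\pmod 4$ and $E_{\ell,m}=D_{\ell,m}$ otherwise. Then $E_{\ell,m}$ is irreducible over $\mathbb Q$, except in the following cases: (1) $\ell=3$ and $m\equiv 4\pmod{12}$, where $E_{\ell,m}$ has a factor $X^2-X+1$; (2) $\ell=3$ and $m\equiv 3\pmod 6$, where there is a factor $X^2+X+1$; (3) $\ell=3$ and $m\equiv 5\pmod{20}$, where there is a factor $X^4-X^3+X^2-X+1$; (4) $\ell=4$ and $m\equiv 3\pmod 8$, where there is a factor $X^2+1$; (5) $\ell=5$ and $m\equiv 3\pmod{12}$, where there is a factor $X^2-X+1$.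
   Context: For $\ell,m\ge3$, $X_{\ell,m}$ denotes the $\ell$-regular graph which is the $1$-skeleton of the tessellation of the sphere, Euclidean plane or hyperbolic plane (according as $(\ell-2)(m-2)<4$, $=4$, $>4$) by regular $m$-gons, $\ell$ meeting at each vertex. With a base vertex $*$ and $|x|$ the graph distance from $x$ to $*$, its growth series is $F_{\ell,m}(X)=\sum_{x}X^{|x|}$. By a result of Floyd and Plotnick, $F_{\ell,m}=N_{\ell,m}/D_{\ell,m}$, where $D_{\ell,m}$ is the polynomial in the claim and $N_{\ell,m}=1+2X+\dots+2X^{w-1}+X^w$ for $m=2w$, $N_{\ell,m}=1+2X+\dots+2X^{w-1}+4X^w+2X^{w+1}+\dots+2X^{2w-1}+X^{2w}$ for $m=2w+1$; $D_{\ell,m}$ is ''the denominator of the growth series''. A polynomial $f=f_0+\dots+f_nX^n$ ($f_n\ne0$) is reciprocal if $f_i=f_{n-i}$ for all $i$. A Salem polynomial is a monic $f\in\mathbb Z[X]$ having exactly one root $\lambda$ with $|\lambda|>1$, this root being simple. *)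

(* Defs.v *)
From HB Require Import structures.
From mathcomp Require Import all_boot all_order all_algebra all_field.
Set Implicit Arguments. Unset Strict Implicit. Unset Printing Implicit Defensive.
Import Order.TTheory GRing.Theory Num.Theory.
Local Open Scope ring_scope.

Definition Ddeg (m : nat) : nat := if odd m then (m./2).*2 else m./2.

Definition Dcoef (l m i : nat) : int :=
  if (i == 0%N) || (i == Ddeg m) then 1
  else if odd m && (i == m./2) then - (l%:Z - 4)
  else - (l%:Z - 2).

(* The denominator of the growth series D_{l,m} in Z[X]. *)
Definition Dpoly (l m : nat) : {poly int} := \poly_(i < (Ddeg m).+1) Dcoef l m i.

Definition Epoly (l m : nat) : {poly rat} :=
  let D := map_poly (fun z : int => z%:~R) (Dpoly l m) : {poly rat} in
  if ((m %% 4)%N == 2%N) then D %/ ('X + 1) else D.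

Definition reciprocal (f : {poly int}) : Prop :=
  f != 0 /\ forall i : nat, (i <= (size f).-1)%N -> f`_i = f`_((size f).-1 - i).

Definition salem_poly (f : {poly int}) : Prop :=
  let fC := map_poly (fun z : int => z%:~R) f : {poly algC} in
  f \is monic /\
  exists lam : algC,
    [/\ root fC lam, 1 < `|lam|, ~~ (('X - lam%:P) ^+ 2 %| fC)
      & forall z : algC, root fC z -> 1 < `|z| -> z = lam].

(* Main.v *)
(* Put [k = l - 1] and [v = X ^ (m./2)]. Then [(X - 1) * D = X * M(v) - N(v)], with [M = v
   + k], [N = k v + 1] for even [m] and [M = v^2 + 2 v + k], [N = k v^2 + 2 v + 1] for odd
   [m], so that a root of [D] other than 1 is a fixed point of the Blaschke product [N / M]
   composed with a power. The Schwarz-Pick kernel of this map is an explicit sum of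
   squares, hence there is at most one root outside the unit disk. It exists because [D(1)
   < 0], and it is simple by an arithmetic-geometric mean inequality. By Kronecker's
   theorem, a factor of [D] avoiding that root has only roots of unity as roots. These are
   determined by congruences in the ring of algebraic integers: if an integer [j >= 2]
   divides [rho - 1] for a root of unity [rho], then [rho = 1], or [j = 2] and [rho = -1]. *)
Require Import Defs.
From HB Require Import structures.
From mathcomp Require Import all_boot all_order all_algebra all_field.
From mathcomp Require Import ring lra zify.
Import Order.TTheory GRing.Theory Num.Theory.
Local Open Scope ring_scope.

(** * Closed form, reciprocity and value at 1 of D *)

Lemma Ddeg_gt0 m : (2 <= m)%N -> (0 < Ddeg m)%N.
Proof. by move=> m2; rewrite /Ddeg; case: ifP => _; lia. Qed.

Lemma DpolyE l m : (2 <= m)%N ->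
  Dpoly l m = 'X^(Ddeg m) + 1 - (l%:Z - 2) *: (\sum_(i < Ddeg m) 'X^i - 1)
              + (odd m)%:R *: (2 *: 'X^(m./2)).
Proof.
move=> m2; have d0 := Ddeg_gt0 _ m2.
have -> : \sum_(i < Ddeg m) 'X^i = \poly_(i < Ddeg m) 1 :> {poly int}.
  by rewrite poly_def; apply: eq_bigr => i _; rewrite scale1r.
apply/polyP => i; rewrite !(coefE, coefZ) /Dcoef.
have [->|i0] := eqVneq i 0%N.
  rewrite d0 /= eq_sym (gtn_eqF d0) /= [0%N == _]eq_sym.
  by rewrite (_ : (m./2 == 0)%N = false) ?mulr0; lia.
have [->|id] := eqVneq i (Ddeg m).
  rewrite ltnSn ltnn /=; case: (boolP (odd m)) => om /=; last by lia.
  rewrite (_ : (Ddeg m == m./2) = false) /=; first by lia.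
  by rewrite /Ddeg om; apply/negbTE; lia.
rewrite ltnS leq_eqVlt (negbTE id) /=; case: ltnP => ltid.
  case: (boolP (odd m)) => om /=; case: eqP => hi; rewrite /= ?mulr0n ?mulr1n; ring.
have -> : (i == m./2) = false by move: ltid id; rewrite /Ddeg; case: ifP => _; lia.
by rewrite mulr0n; ring.
Qed.

(** Multiplication by ['X - 1] telescopes the geometric sum in D; regrouped, the result is
    [X M(v) - N(v)], linear in ['X] for fixed [v]. *)
Lemma mul_Dpoly l m : (2 <= m)%N ->
  let k := (l%:Z - 1)%:P in let v := 'X^(m./2) : {poly int} in
  ('X - 1) * Dpoly l m =
  if odd m then v ^+ 2 * ('X - k) + 2 * v * ('X - 1) + (k * 'X - 1)
  else v * ('X - k) + (k * 'X - 1).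
Proof.
move=> m2 k v; rewrite DpolyE // mulrDr mulrBr -scalerAr mulrBr -subrX1.
have -> : forall (a : int) (p : {poly int}), a *: p = a%:P * p.
  by move=> a p; rewrite mul_polyC.
have -> : l%:Z - 2 = (l%:Z - 1) - 1 by lia.
rewrite [in RHS]/k; set k' := l%:Z - 1; rewrite polyCB -/k.
have -> : 'X^(Ddeg m) = if odd m then v ^+ 2 else v.
  by rewrite /Ddeg /v; case: ifP => // _; rewrite -exprM muln2.
by case: odd; rewrite /= ?scale1r ?scale0r ?scaler_nat ?polyC1 -/v; clearbody k v; ring.
Qed.

Lemma horner_Dpoly (R : comNzRingType) l m (z : R) : (2 <= m)%N ->
  let k := l%:R - 1 in let v := z ^+ (m./2) in
  (z - 1) * (map_poly intr (Dpoly l m)).[z] =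
  if odd m then v ^+ 2 * (z - k) + 2 * v * (z - 1) + (k * z - 1)
  else v * (z - k) + (k * z - 1).
Proof.
move=> m2 k v; have /= := congr1 (fun p => (map_poly intr p).[z]) (mul_Dpoly l m m2).
rewrite rmorphM /= hornerM rmorphB /= map_polyX rmorph1 !hornerE => ->.
by case: odd; rewrite !(rmorphD, rmorphN, rmorphM, rmorphXn, rmorph1) /= ?map_polyC /= ?map_polyX ?rmorph_nat !hornerE /= ?hornerXn -?/v; rewrite hornerMn hornerE -/k; ring.
Qed.

Lemma size_Dpoly l m : (2 <= m)%N -> size (Dpoly l m) = (Ddeg m).+1.
Proof. by move=> m2; rewrite size_poly_eq // /Dcoef eqxx orbT. Qed.

Lemma Dpoly_monic l m : (2 <= m)%N -> Dpoly l m \is monic.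
Proof.
by move=> m2; rewrite monicE lead_coefE size_Dpoly // coef_poly ltnSn /Dcoef eqxx orbT.
Qed.

Lemma Dpoly_reciprocal l m : (2 <= m)%N -> reciprocal (Dpoly l m).
Proof.
move=> m2; split=> [|i]; first exact/monic_neq0/Dpoly_monic.
rewrite size_Dpoly //= => lid; rewrite !coef_poly !ltnS lid leq_subr /Dcoef.
have -> : (Ddeg m - i == 0)%N = (i == Ddeg m) by lia.
have -> : (Ddeg m - i == Ddeg m)%N = (i == 0%N) by lia.
rewrite orbC; case: ifP => // _; case: (boolP (odd m)) => //= om.
suff -> : (Ddeg m - i == m./2)%N = (i == m./2) by [].
by move: lid; rewrite /Ddeg om; lia.
Qed.

(** The value is [4 - (l - 2) (m - 2)] for odd [m] and half of it for even [m], so hyperbolicity is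
    exactly its negativity. *)
Lemma Dpoly_at1 l m : (3 <= l)%N -> (3 <= m)%N -> (4 < (l - 2) * (m - 2))%N ->
  (Dpoly l m).[1] < 0.
Proof.
move=> l3 m3 hlm; rewrite DpolyE ?(ltnW m3) // !hornerE !expr1n.
rewrite horner_sum (eq_bigr (fun=> 1)) => [|i _]; last by rewrite hornerXn expr1n.
rewrite sumr_const card_ord.
have [j mE] : exists j, m = (j * 2 + odd m).+2 by exists (m./2).-1; lia.
have -> : Ddeg m = if odd m then (j * 2).+2 else j.+1.
  by rewrite /Ddeg; case: ifP => om; rewrite om in mE; lia.
case: (odd m) mE => mE; subst m.
  by rewrite /= !mulr1; nia.
by rewrite mulr0n /= !mul0r; nia.
Qed.

(** * Uniqueness of the root outside the unit disk *)

(** For the Hermitian form with weights [a], the squared norm of [f - g] is [1 - 1 - 1 + 1 = 0], so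
    the coordinates of positive weight agree. *)
Lemma gram_ones_eq (I : finType) (a : I -> algC) (f g : I -> algC) :
  (forall i, 0 <= a i) ->
  \sum_i a i * ((f i)^* * f i) = 1 -> \sum_i a i * ((g i)^* * g i) = 1 ->
  \sum_i a i * ((f i)^* * g i) = 1 -> forall i, 0 < a i -> f i = g i.
Proof.
move=> a0 ff gg fg i ai.
have gf : \sum_i a i * ((g i)^* * f i) = 1.
  rewrite -[1]conjC1 -fg rmorph_sum; apply: eq_bigr => j _.
  by rewrite /= !rmorphM /= conjCK (conj_Creal (ger0_real (a0 j))) [f j * _]mulrC.
have : \sum_i a i * ((f i - g i)^* * (f i - g i)) = 0.
  transitivity (1 - 1 - 1 + 1 : algC); last by ring.
  rewrite -{1}ff -{1}fg -{1}gf -gg -!sumrB -big_split; apply: eq_bigr => j _ /=.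
  by rewrite rmorphB /=; ring.
move/eqP; rewrite psumr_eq0 => [/allP/(_ i)|j _].
  rewrite mem_index_enum => /(_ isT) /=.
  by rewrite mulf_eq0 gt_eqF //= -normCKC sqrf_eq0 normr_eq0 subr_eq0 => /eqP.
by rewrite mulr_ge0 // -normCKC exprn_ge0.
Qed.

(* The Gram matrix of the functions [z ^ p * e_q / M] at two fixed points is all ones,
   so each of these functions takes the same value at both points. *)
Lemma kernel_rigidity (r w : nat) (c : 'I_r -> algC) (c_ge0 : forall q, 0 <= c q)
  (e1 e2 : 'I_r -> algC) (z1 z2 M1 M2 : algC) :
  (0 < w)%N -> 1 < `|z1| -> 1 < `|z2| -> M1 != 0 -> M2 != 0 ->
  (z1^* * z1 - 1) * (M1^* * M1) =
    ((z1^* * z1) ^+ w - 1) * \sum_q c q * ((e1 q)^* * e1 q) ->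
  (z2^* * z2 - 1) * (M2^* * M2) =
    ((z2^* * z2) ^+ w - 1) * \sum_q c q * ((e2 q)^* * e2 q) ->
  (z1^* * z2 - 1) * (M1^* * M2) =
    ((z1^* * z2) ^+ w - 1) * \sum_q c q * ((e1 q)^* * e2 q) ->
  forall q, 0 < c q -> e1 q * M2 = e2 q * M1.
Proof.
move=> w0 z1_gt z2_gt M1n0 M2n0 h11 h22 h12 q cq.
(* The exponents below [w] come from expanding [(t ^ w - 1) / (t - 1)], with [t = z1^* * z2], as a
   geometric sum. *)
pose f (e : 'I_r -> algC) z M (x : 'I_w * 'I_r) := z ^+ x.1 * e x.2 / M.
have key x1 x2 N1 N2 (d1 d2 : 'I_r -> algC) : 1 < `|x1| -> 1 < `|x2| ->
    N1 != 0 -> N2 != 0 ->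
    (x1^* * x2 - 1) * (N1^* * N2) =
      ((x1^* * x2) ^+ w - 1) * \sum_q c q * ((d1 q)^* * d2 q) ->
    \sum_(x : 'I_w * 'I_r) c x.2 * ((f d1 x1 N1 x)^* * f d2 x2 N2 x) = 1.
  move=> x1_gt x2_gt N1n0 N2n0; rewrite subrX1 -mulrA => h.
  have x12 : x1^* * x2 - 1 != 0.
    apply/eqP => /subr0_eq /(congr1 Num.norm).
    by rewrite normrM norm_conjC normr1 => /eqP; rewrite gt_eqF ?mulr_egt1.
  have {h} := mulfI x12 h; rewrite big_distrlr /= pair_bigA /= => h.
  have NN : N1^* * N2 != 0 by rewrite mulf_neq0 ?fmorph_eq0.
  apply: (mulfI NN); rewrite mulr1 [RHS]h big_distrr; apply: eq_bigr => -[p j] _.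
  rewrite /f /= !rmorphM /= rmorphXn fmorphV /= exprMn.
  by field; rewrite N2n0 fmorph_eq0.
(* The index with exponent 0 leaves just [e q / M]. *)
have := @gram_ones_eq _ (fun x => c x.2) _ _ (fun x => c_ge0 x.2)
  (key _ _ _ _ _ _ z1_gt z1_gt M1n0 M1n0 h11) (key _ _ _ _ _ _ z2_gt z2_gt M2n0 M2n0 h22)
  (key _ _ _ _ _ _ z1_gt z2_gt M1n0 M2n0 h12) (Ordinal w0, q) cq.
rewrite /f /= !expr0 !mul1r => /eqP.
by rewrite eqr_div // => /eqP.
Qed.

(** * Simplicity and existence of the real root beyond 1 *)

(** Arithmetic-geometric mean inequality for [n] copies of [x ^ n.+1] and one 1. *)
Lemma bernoulli_rev (R : realDomainType) (x : R) n : 1 < x ->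
  (n.+1)%:R * x ^+ n <= n%:R * x ^+ n.+1 + 1 ?= iff (n == 0)%N.
Proof.
move=> x1; elim: n => [|n [IH IHe]]; first by rewrite expr0 mulr1 mul0r add0r; apply/leif_refl.
have x0 : 0 < x by apply: lt_trans x1.
suff h : (n.+2)%:R * x ^+ n.+1 < (n.+1)%:R * x ^+ n.+2 + 1.
  by split; [exact: ltW | rewrite lt_eqF].
have h1 : 0 < (x - 1) * (x ^+ n.+1 - 1).
  by rewrite mulr_gt0 // subr_gt0 // exprn_egt1.
have h2 : 0 <= x * (n%:R * x ^+ n.+1 + 1 - n.+1%:R * x ^+ n).
  by apply: mulr_ge0; rewrite ?subr_ge0 // ltW.
rewrite -subr_gt0; apply: etrans _ (ltr_pwDl h1 h2); congr (0 < _).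
by rewrite !mulrS !exprS; ring.
Qed.

(** Divided by [x (x ^ 2 - 1)], this is the mean inequality for [1, x ^ 2, ..., x ^ (2 (w - 1))],
    whose geometric mean is [x ^ (w - 1)]. *)
Lemma geometric_mean_lt (R : realDomainType) (x : R) w : 1 < x -> (0 < w)%N ->
  w%:R * x ^+ w * (x ^+ 2 - 1) <= x * (x ^+ (2 * w) - 1) ?= iff (w == 1)%N.
Proof.
move=> x1; case: w => // w _.
have x0 : 0 < x by apply: lt_trans x1.
have xx : 0 < x ^+ 2 - 1 by rewrite subr_gt0 exprn_egt1.
elim: w => [|w [IH _]]; first by rewrite (_ : _ * _ = x * (x ^+ (2 * 1) - 1)); [apply/leif_refl | rewrite mul1r].
have [b1 b2] := bernoulli_rev _ x w.+1 x1.
have lt : (w.+2)%:R * x ^+ w.+1 < w.+1%:R * x ^+ w.+2 + 1 by rewrite lt_neqAle b1 b2.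
suff h : w.+2%:R * x ^+ w.+2 * (x ^+ 2 - 1) < x * (x ^+ (2 * w.+2) - 1).
  by split; [exact: ltW | rewrite lt_eqF].
have h1 : 0 < x * (x ^+ 2 - 1) * (w.+1%:R * x ^+ w.+2 + 1 - (w.+2)%:R * x ^+ w.+1).
  by rewrite !mulr_gt0 // subr_gt0.
have h2 : 0 <= x ^+ 2 * (x * (x ^+ (2 * w.+1) - 1) - w.+1%:R * x ^+ w.+1 * (x ^+ 2 - 1)).
  by apply: mulr_ge0; rewrite ?subr_ge0 // exprn_ge0 // ltW.
rewrite -subr_gt0; apply: etrans _ (ltr_pwDl h1 h2); congr (0 < _).
have -> : (2 * w.+2 = 2 * w.+1 + 2)%N by lia.
by rewrite exprD !mulrS !exprS; ring.
Qed.
Lemma root_Dpoly_eq (R : comNzRingType) l m (z : R) : (2 <= m)%N ->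
  root (map_poly intr (Dpoly l m)) z ->
  let k := l%:R - 1 in let v := z ^+ (m./2) in
  if odd m then z * (v ^+ 2 + 2 * v + k) = k * v ^+ 2 + 2 * v + 1
  else z * (v + k) = k * v + 1.
Proof.
move=> m2 /eqP z0 k v; have := @horner_Dpoly R l m z m2; rewrite z0 mulr0 -/k -/v.
by case: odd => /esym/eqP h; apply/eqP; rewrite -subr_eq0 -(eqP h); apply/eqP; ring.
Qed.

(** Since [z M(v) = N(v)] at both roots, the left side of the kernel identity is
    [N1^* N2 - M1^* M2], and dividing it by [v1^* v2 - 1] leaves a sum of products with positive
    weights, as [kernel_rigidity] requires. *)
Lemma Dpoly_root_gt1_uniq l m (z1 z2 : algC) : (3 <= l)%N -> (3 <= m)%N ->
  root (map_poly intr (Dpoly l m)) z1 -> root (map_poly intr (Dpoly l m)) z2 ->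
  1 < `|z1| -> 1 < `|z2| -> z1 = z2.
Proof.
move=> l3 m3 r1 r2 g1 g2; have m2 := ltnW m3.
have w0 : (0 < m./2)%N by lia.
have := root_Dpoly_eq _ _ _ _ m2 r1; have := root_Dpoly_eq _ _ _ _ m2 r2 => /=.
set k : algC := l%:R - 1; set v1 := z1 ^+ _; set v2 := z2 ^+ _.
have k1 : 1 < k by rewrite ltrBrDr (ltr_nat _ 2).
have k10 : 0 < k - 1 by rewrite subr_gt0.
have kR : k^* = k by rewrite rmorphB rmorph_nat rmorph1.
clearbody k.
have gv (z : algC) : 1 < `|z| -> 1 < `|z ^+ m./2| by move=> g; rewrite normrX exprn_egt1 // -lt0n.
case: ifP => om.
  pose M (v : algC) := v ^+ 2 + 2 * v + k.
  (* A common zero of [M] and [N] would be one of [N - M = (k - 1) (v ^ 2 - 1)], impossible for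
     [|v| > 1]. *)
  have Mn0 (v z : algC) : 1 < `|v| -> z * M v = k * v ^+ 2 + 2 * v + 1 -> M v != 0.
    move=> gv' h; apply/eqP => M0; rewrite M0 mulr0 in h.
    have : (k - 1) * (v ^+ 2 - 1) = 0.
      by transitivity (k * v ^+ 2 + 2 * v + 1 - M v); [rewrite /M; ring | rewrite -h M0 subrr].
    move/eqP; rewrite mulf_eq0 gt_eqF //= subr_eq0 => /eqP/(congr1 Num.norm)/eqP.
    by rewrite normrX normr1 gt_eqF // exprn_egt1.
  move=> h2 h1.
  (* The kernel is [(k - 1) ^ 2 (1 + v1^* v2) + 2 (k - 1) (1 + v1^* ) (1 + v2)]. *)
  pose c (q : 'I_3) := nth 0 [:: (k - 1) ^+ 2; (k - 1) ^+ 2; 2 * (k - 1)] q.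
  pose e (v : algC) (q : 'I_3) := nth 0 [:: 1; v; 1 + v] q.
  have kern (x1 x2 u1 u2 : algC) : u1 = x1 ^+ m./2 -> u2 = x2 ^+ m./2 ->
      x1 * M u1 = k * u1 ^+ 2 + 2 * u1 + 1 -> x2 * M u2 = k * u2 ^+ 2 + 2 * u2 + 1 ->
      (x1^* * x2 - 1) * ((M u1)^* * M u2) =
      ((x1^* * x2) ^+ m./2 - 1) * \sum_q c q * ((e u1 q)^* * e u2 q).
    move=> d1 d2 /(congr1 Num.conj) H1 H2.
    rewrite exprMn -rmorphXn -d1 -d2 !big_ord_recl big_ord0 /c /e /=.
    transitivity ((x1 * M u1)^* * (x2 * M u2) - (M u1)^* * M u2).
      by rewrite rmorphM /=; ring.
    rewrite H1 H2 /M !(rmorphD, rmorphM, rmorphXn, rmorph1, rmorph_nat) /= kR.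
    by ring.
  have c0 q : 0 <= c q.
    case: q => -[|[|[|//]]] ?; rewrite /c /=; rewrite ?exprn_ge0 ?mulr_ge0 //; exact: ltW.
  have rig := kernel_rigidity _ _ _ c0 (e v1) (e v2) _ _ (M v1) (M v2) w0 g1 g2
    (Mn0 _ _ (gv _ g1) h1) (Mn0 _ _ (gv _ g2) h2)
    (kern _ _ _ _ erefl erefl h1 h1) (kern _ _ _ _ erefl erefl h2 h2)
    (kern _ _ _ _ erefl erefl h1 h2).
  have cp : 0 < (k - 1) ^+ 2 by rewrite exprn_gt0.
  (* The components 1 and [v] of [e] give [M v1 = M v2], then [v1 = v2]. *)
  have M12 : M v1 = M v2 by have := rig ord0 cp; rewrite /e /= !mul1r.
  have v12 : v1 = v2.
    by have := rig (Ordinal (isT : 1 < 3)%N) cp; rewrite /e /= M12 => /mulIf -> //; exact: (Mn0 _ z2 (gv _ g2)).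
  by apply: (mulIf (Mn0 _ _ (gv _ g1) h1)); rewrite [LHS]h1 -/(M v1) M12 [RHS]h2 v12.
pose M (v : algC) := v + k.
have kk : 0 < k ^+ 2 - 1 by rewrite subr_gt0 exprn_egt1.
have Mn0 (v z : algC) : z * M v = k * v + 1 -> M v != 0.
  move=> h; apply/eqP => M0; rewrite M0 mulr0 in h.
  have : k ^+ 2 - 1 = 0 by transitivity (k * M v - (k * v + 1)); [rewrite /M; ring | rewrite -h M0; ring].
  by move/eqP; rewrite gt_eqF.
move=> h2 h1.
have kern (x1 x2 u1 u2 : algC) : u1 = x1 ^+ m./2 -> u2 = x2 ^+ m./2 ->
    x1 * M u1 = k * u1 + 1 -> x2 * M u2 = k * u2 + 1 ->
    (x1^* * x2 - 1) * ((M u1)^* * M u2) =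
    ((x1^* * x2) ^+ m./2 - 1) * \sum_(q < 1) (k ^+ 2 - 1) * (1^* * 1).
  move=> d1 d2 /(congr1 Num.conj) H1 H2.
  rewrite exprMn -rmorphXn -d1 -d2 big_ord_recl big_ord0 /=.
  transitivity ((x1 * M u1)^* * (x2 * M u2) - (M u1)^* * M u2).
    by rewrite rmorphM /=; ring.
  by rewrite H1 H2 /M !(rmorphD, rmorphM, rmorph1) /= kR; ring.
have := kernel_rigidity _ _ (fun=> k ^+ 2 - 1) (fun=> ltW kk) (fun=> 1) (fun=> 1)
    _ _ (M v1) (M v2) w0 g1 g2 (Mn0 _ _ h1) (Mn0 _ _ h2)
    (kern _ _ _ _ erefl erefl h1 h1) (kern _ _ _ _ erefl erefl h2 h2)
    (kern _ _ _ _ erefl erefl h1 h2) ord0 kk.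
rewrite !mul1r => /esym M12; have v12 : v1 = v2 by apply: (addIr k).
by apply: (mulIf (Mn0 _ _ h1)); rewrite [LHS]h1 M12 [RHS]h2 v12.
Qed.

(** At a double root, [x M(v) = N(v)] may be differentiated. Combined with the kernel identity at
    [z1 = z2 = x], this compares [w v (x ^ 2 - 1)] with [x (v ^ 2 - 1)] and contradicts
    [geometric_mean_lt]. *)
Lemma Dpoly_simple_root (R : realFieldType) l m (x : R) : (3 <= l)%N -> (3 <= m)%N ->
  1 < x -> root (map_poly intr (Dpoly l m)) x ->
  (map_poly intr (Dpoly l m))^`().[x] != 0.
Proof.
move=> l3 m3 x1 rx; have m2 := ltnW m3; apply/eqP => d0.
have w0 : (0 < m./2)%N by lia.
have x0 : 0 < x := lt_trans ltr01 x1.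
have := root_Dpoly_eq _ _ _ _ m2 rx.
set k : R := l%:R - 1; set v := x ^+ _; move=> /= h.
have k1 : 1 < k by rewrite ltrBrDr (ltr_nat _ 2).
have v1 : 1 < v by rewrite exprn_egt1 // -lt0n.
have kE : map_poly intr (l%:Z - 1)%:P = k%:P :> {poly R}.
  by rewrite map_polyC /= rmorphB rmorph1.
have /= := mul_Dpoly l m m2; move: kE; generalize (l%:Z - 1)%:P => kp kE.
(* Multiplying the derivative by [x] turns that of ['X^(m./2)] into a multiple of [v], without a
   predecessor in the exponent. *)
move/(congr1 (fun p => x * (map_poly intr p)^`().[x])).
have dv : x * ('X^(m./2))^`().[x] = (m./2)%:R * v.
  by rewrite derivXn hornerMn hornerXn mulrnAr -exprS prednK // mulr_natl.
rewrite rmorphM derivM hornerD !hornerM d0 (eqP rx) !mulr0 addr0 mulr0 /=.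
have [ag ag'] := geometric_mean_lt _ _ _ x1 w0.
rewrite mulnC exprM -/v in ag ag'.
have B0 : 0 < x * (v ^+ 2 - 1) by rewrite mulr_gt0 // subr_gt0 exprn_egt1.
have X0 : 0 < x ^+ 2 - 1 by rewrite subr_gt0 exprn_egt1.
have hV : 'X^(m./2).[x] = v by rewrite hornerXn.
clearbody k; set W := (m./2)%:R * v in dv ag ag'.
case: ifP h => om h.
  set M := v ^+ 2 + 2 * v + k in h.
  rewrite !(rmorphD, rmorphN, rmorphM, rmorphXn, rmorph1) /= kE !map_polyX.
  suff core (V : {poly R}) : V.[x] = v -> x * V^`().[x] = W ->
      x * (V * V * ('X - k%:P) + (1 + 1) * V * ('X - 1) + (k%:P * 'X - 1))^`().[x] != 0.
    by move/esym/eqP; apply/negP; exact: core.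
  move=> Vx dVx; rewrite !(derivD, derivN, derivM, derivX, derivC).
  rewrite !(hornerD, hornerN, hornerM, hornerX, hornerC) Vx.
  apply/negP => /eqP e.
  (* The factor of [W] is the Wronskian [N' M - N M'] with respect to [v]. *)
  have {}e : W * (2 * (k - 1) * (v ^+ 2 + (k + 1) * v + 1)) = x * M * M.
    have e' : 2 * v * (x - k) * W + 2 * (x - 1) * W + x * M = 0.
      by rewrite -[RHS]e -dVx /M; ring.
    apply/eqP; rewrite -subr_eq0 -oppr_eq0; apply/eqP.
    transitivity (2 * v * (x * M - k * M) * W + 2 * (x * M - M) * W + M * (x * M)).
      by rewrite {2 3}h /M; ring.
    by rewrite -[RHS](mulr0 M) -e'; ring.
  have kern : (x ^+ 2 - 1) * (M * M) =
      (v ^+ 2 - 1) * ((k - 1) * ((k + 1) * (v ^+ 2 + 1) + 4 * v)).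
    by transitivity ((x * M) ^+ 2 - M ^+ 2); [ring | rewrite h /M; ring].
  have k10 : k - 1 != 0 by rewrite gt_eqF // subr_gt0.
  have e2 : W * (x ^+ 2 - 1) * (2 * (v ^+ 2 + (k + 1) * v + 1)) =
      x * (v ^+ 2 - 1) * ((k + 1) * (v ^+ 2 + 1) + 4 * v).
    apply: (mulfI k10).
    transitivity ((x ^+ 2 - 1) * (x * M * M)); first by rewrite -e; ring.
    by transitivity (x * ((x ^+ 2 - 1) * (M * M))); [ring | rewrite kern; ring].
  have C0 : 0 < 2 * (v ^+ 2 + (k + 1) * v + 1) by nra.
  (* This gap makes the final comparison strict even for [m = 3], where the mean inequality is an
     equality. *)
  have CE : 2 * (v ^+ 2 + (k + 1) * v + 1) < (k + 1) * (v ^+ 2 + 1) + 4 * v.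
    rewrite -subr_gt0.
    have -> : (k + 1) * (v ^+ 2 + 1) + 4 * v - 2 * (v ^+ 2 + (k + 1) * v + 1)
       = (k - 1) * (v - 1) ^+ 2 by ring.
    by rewrite mulr_gt0 ?exprn_gt0 // subr_gt0.
  suff : W * (x ^+ 2 - 1) * (2 * (v ^+ 2 + (k + 1) * v + 1)) <
      x * (v ^+ 2 - 1) * ((k + 1) * (v ^+ 2 + 1) + 4 * v) by rewrite e2 ltxx.
  apply: (@le_lt_trans _ _ (x * (v ^+ 2 - 1) * (2 * (v ^+ 2 + (k + 1) * v + 1)))).
    by rewrite ler_wpM2r // ltW.
  by rewrite ltr_pM2l.
rewrite !(rmorphD, rmorphN, rmorphM, rmorphXn, rmorph1) /= kE !map_polyX.
suff core (V : {poly R}) : V.[x] = v -> x * V^`().[x] = W ->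
    x * (V * ('X - k%:P) + (k%:P * 'X - 1))^`().[x] != 0.
  by move/esym/eqP; apply/negP; exact: core.
move=> Vx dVx; rewrite !(derivD, derivN, derivM, derivX, derivC).
rewrite !(hornerD, hornerN, hornerM, hornerX, hornerC) Vx.
apply/negP => /eqP e.
have {}e : W * (k ^+ 2 - 1) = x * (v + k) * (v + k).
  have e' : (x - k) * W + x * (v + k) = 0 by rewrite -[RHS]e -dVx; ring.
  apply/eqP; rewrite -subr_eq0 -oppr_eq0; apply/eqP.
  transitivity ((x * (v + k) - k * (v + k)) * W + (v + k) * (x * (v + k))).
    by rewrite {2}h; ring.
  by rewrite -[RHS](mulr0 (v + k)) -e'; ring.
have kern : (x ^+ 2 - 1) * ((v + k) * (v + k)) = (k ^+ 2 - 1) * (v ^+ 2 - 1).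
  by transitivity ((x * (v + k)) ^+ 2 - (v + k) ^+ 2); [ring | rewrite h; ring].
have k10 : k ^+ 2 - 1 != 0 by rewrite gt_eqF // subr_gt0 exprn_egt1.
have : W * (x ^+ 2 - 1) == x * (v ^+ 2 - 1).
  apply/eqP/(mulfI k10).
  transitivity ((x ^+ 2 - 1) * (x * (v + k) * (v + k))); first by rewrite -e; ring.
  by transitivity (x * ((x ^+ 2 - 1) * ((v + k) * (v + k)))); [ring | rewrite kern; ring].
(* Equality in the mean inequality forces [m./2 = 1], which an even [m >= 3] excludes. *)
by rewrite ag' => /eqP; lia.
Qed.

(** The sign changes between 1 and [k = l - 1]: at [k], [('X - 1) * D] is [k ^ 2 - 1] plus a
    nonnegative term. The field [algR] is real closed, so the intermediate value theorem holds, and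
    it embeds in [algC]. *)
Lemma Dpoly_root_gt1 l m : (3 <= l)%N -> (3 <= m)%N -> (4 < (l - 2) * (m - 2))%N ->
  exists x : algR, 1 < x /\ root (map_poly intr (Dpoly l m)) x.
Proof.
move=> l3 m3 lm; have m2 := ltnW m3.
set p : {poly algR} := map_poly intr _; set k : algR := l%:R - 1.
have k1 : 1 < k by rewrite ltrBrDr (ltr_nat _ 2).
have p1 : p.[1] < 0.
  by rewrite -[1](rmorph1 (intr : int -> algR)) horner_map /= ltrz0 Dpoly_at1.
have pk : 0 <= p.[k].
  have k10 : 0 < k - 1 by rewrite subr_gt0.
  have vk : 0 <= k ^+ m./2 by rewrite exprn_ge0 // (le_trans ler01) // ltW.
  have kk : 0 <= k * k - 1 by rewrite -expr2 subr_ge0 exprn_ege1 // ltW.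
  rewrite -(pmulr_rge0 _ k10) /p /k horner_Dpoly // -/k subrr !mulr0 add0r.
  by case: ifP => // _; rewrite addr_ge0 // !mulr_ge0 // ltW.
have [x /andP[x1 _] rx] : exists2 x, 1 <= x <= k & root p x.
  by apply: poly_ivt; [exact: ltW | rewrite (ltW p1) pk].
exists x; split=> //; rewrite lt_neqAle x1 andbT.
by apply/eqP => x1'; move: p1; rewrite x1' (eqP rx) ltxx.
Qed.

Lemma Dpoly_salem l m : (3 <= l)%N -> (3 <= m)%N -> (4 < (l - 2) * (m - 2))%N ->
  salem_poly (Dpoly l m).
Proof.
move=> l3 m3 lm; split; first exact/Dpoly_monic/ltnW.
have [x [x1 rx]] := Dpoly_root_gt1 _ _ l3 m3 lm.
pose f : {poly algR} := map_poly intr (Dpoly l m).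
have fE : map_poly intr (Dpoly l m) = map_poly algRval f.
  by rewrite -map_poly_comp; apply: eq_map_poly => z /=; rewrite rmorph_int.
exists (algRval x).
have lam1 : 1 < `|algRval x|.
  have x0 : 0 <= x := le_trans ler01 (ltW x1).
  by rewrite ger0_norm.
have rl : root (map_poly intr (Dpoly l m)) (algRval x) by rewrite fE mapf_root.
split=> // [|z rz z1]; last exact: (Dpoly_root_gt1_uniq l m).
rewrite fE -map_polyXsubC -rmorphXn dvdp_map; apply/negP => /dvdpP[q fq].
have /eqP[] := Dpoly_simple_root _ _ _ _ l3 m3 x1 rx.
rewrite -/f fq expr2 !derivM derivXsubC.
by rewrite !(hornerXsubC, hornerD, hornerM) subrr; ring.
Qed.

(** * Roots of unity modulo integers, and their orders *)

Lemma Aint_root_of_unity (z : algC) n : (0 < n)%N -> z ^+ n = 1 -> z \in Aint.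
Proof. by move=> n0 zn; apply: (Aint_unity_root n0); apply/unity_rootP. Qed.

Lemma norm_root_of_unity (z : algC) n : (0 < n)%N -> z ^+ n = 1 -> `|z| = 1.
Proof.
move=> n0 zn; apply/eqP; rewrite -(@pexpr_eq1 _ _ n) //.
by rewrite -normrX zn normr1.
Qed.

(** For [rho != 1], the product of all conjugates of [(1 - rho) / j] is a nonzero rational algebraic
    integer, so of modulus at least 1, while each factor has modulus at most [2 / j]. Hence [j = 2]
    and [|1 - rho| = 2]. *)
Lemma Aint_sub1_div_nat (rho : algC) n j : (0 < n)%N -> rho ^+ n = 1 -> (2 <= j)%N ->
  (rho - 1) / j%:R \in Aint -> rho = 1 \/ j = 2%N /\ rho = -1.
Proof.
move=> n0 rn j2 Aj.
have [->|r1] := eqVneq rho 1; [by left | right].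
have [N prN _] := prim_order_exists n0 rn.
have N0 := prim_order_gt0 prN.
have N1 : (1 < N)%N.
  rewrite ltn_neqAle N0 andbT; apply: contraNneq r1 => N1.
  by move: (prim_expr_order prN); rewrite -N1 expr1 => ->.
have j0 : 0 < j%:R :> algC by rewrite ltr0n (ltn_trans _ j2).
have rnorm i : `|rho ^+ i| = 1.
  by rewrite normrX (norm_root_of_unity _ _ n0 rn) expr1n.
pose P := \prod_(i < N | coprime i N) ((1 - rho ^+ i) / j%:R).
have PA : P \in Aint.
  apply: rpred_prod => i _.
  have -> : (1 - rho ^+ i) / j%:R = - ((rho - 1) / j%:R * \sum_(t < i) rho ^+ t).
    by rewrite mulrAC -subrX1 -mulNr opprB.
  rewrite rpredN rpredM // rpred_sum // => t _.
  by rewrite rpredX // (Aint_root_of_unity _ _ n0).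
have PQ : P \in Crat.
  (* Up to a power of [j], this norm is the value at 1 of the cyclotomic polynomial. *)
  have -> : P = ((map_poly intr 'Phi_N).[1]) / \prod_(i < N | coprime i N) j%:R.
    rewrite (Cintr_Cyclotomic prN) horner_prod -prodf_div; apply: eq_bigr => i _.
    by rewrite hornerXsubC.
  rewrite rpred_div //; last by apply: rpred_prod => i _; exact: rpred_nat.
  by rewrite -[1](rmorph1 (intr : int -> algC)) horner_map /= rpred_int.
have P0 : P != 0.
  rewrite prodf_seq_neq0; apply/allP => i _; apply/implyP => co.
  rewrite mulf_eq0 invr_eq0 (gt_eqF j0) orbF subr_eq0 eq_sym -(prim_order_dvd prN).
  apply/negP => /gcdn_idPr; rewrite gcdnC => g.
  by move: co; rewrite /coprime gcdnC g => /eqP h; rewrite h in N1.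
have P1 : 1 <= `|P|.
  by have /intrP[x Px] := Cint_rat_Aint PQ PA; rewrite Px norm_intr_ge1 // ?rpred_int // -Px.
have le2 i : `|1 - rho ^+ i| <= 2.
  by rewrite (le_trans (ler_normB _ _)) // normr1 rnorm.
have lei i : `|(1 - rho ^+ i) / j%:R| <= 1.
  rewrite normrM normfV (ger0_norm (ltW j0)) ler_pdivrMr // mul1r.
  by rewrite (le_trans (le2 _)) // ler_nat.
have : `|P| <= `|(1 - rho ^+ 1) / j%:R|.
  rewrite /P (bigD1 (Ordinal N1)) ?coprime1n //= normrM ler_piMr // normr_prod.
  by apply: prodr_ile1 => i _; rewrite normr_ge0 lei.
move/(le_trans P1); rewrite normrM normfV (ger0_norm (ltW j0)) ler_pdivlMr // mul1r => lej.
have j2' : j = 2%N.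
  by apply/eqP; rewrite eqn_leq j2 andbT -(ler_nat algC) (le_trans lej).
split=> //; have {lej} : `|1 - rho ^+ 1| ^+ 2 = 4.
  rewrite (_ : `|1 - _| = 2) ?expr2; first by ring.
  by apply/eqP; rewrite eq_le le2 -j2'.
have : rho * rho^* = 1 by rewrite -normCK (rnorm 1%N) expr1n.
rewrite expr1 normCK rmorphB rmorph1 => h1 h2.
(* Parallelogram identity: [|1 + rho| ^ 2 = 4 - |1 - rho| ^ 2 = 0]. *)
apply/eqP; rewrite -addr_eq0 -normr_eq0 -sqrf_eq0 normCK rmorphD rmorph1.
apply/eqP; transitivity (2 + 2 * (rho * rho^*) - (1 - rho) * (1 - rho^*)); first by ring.
by rewrite h1 h2; ring.
Qed.

Lemma nat_inv_Aint (a j : nat) : (0 < j)%N -> a%:R / j%:R \in Aint -> (j %| a)%N.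
Proof.
move=> j0 aj; have : a%:R / j%:R \in (Num.int : {pred algC}).
  by apply: Cint_rat_Aint aj; rewrite rpred_div ?rpred_nat.
move=> h; have : (j %| a)%C.
  by apply/dvdCP; exists (a%:R / j%:R) => //; rewrite divfK // pnatr_eq0 -lt0n.
by rewrite dvdC_nat.
Qed.

Lemma primitive_rootP (R : idomainType) (z : R) n : (0 < n)%N -> z ^+ n = 1 ->
  (forall p, prime p -> (p %| n)%N -> z ^+ (n %/ p) != 1) -> n.-primitive_root z.
Proof.
move=> n0 zn h; have [d prd dn] := prim_order_exists n0 zn.
have [<- //|ddn] := eqVneq d n.
have d0 := prim_order_gt0 prd.
have q1 : (1 < n %/ d)%N.
  by rewrite ltn_divRL // mul1n ltn_neqAle ddn dvdn_leq.
have dn' : (n %/ d %| n)%N by rewrite -[X in (_ %| X)%N](divnK dn) dvdn_mulr.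
have := h _ (pdiv_prime q1) (dvdn_trans (pdiv_dvd _) dn').
have := prime_gt0 (pdiv_prime q1); have [c] := dvdnP (pdiv_dvd (n %/ d)).
move: (pdiv _) => p cE p0 /eqP[]; apply/eqP; rewrite -(prim_order_dvd prd).
by rewrite -(divnK dn) cE mulnAC mulnK // dvdn_mull.
Qed.

(** Exact orders, here and for the next three cyclotomic polynomials, turn equalities
    [z ^ m./2 = z ^ r] into congruences for [m./2]. *)
Lemma prim_root6 (z : algC) : z ^+ 2 - z + 1 = 0 -> 6.-primitive_root z.
Proof.
move=> h; have z3 : z ^+ 3 = -1.
  by apply/eqP; rewrite -subr_eq0 -(mulr0 (z + 1)) -h; apply/eqP; ring.
apply: primitive_rootP => // [|p pp pd].
  by rewrite (exprM z 3 2) z3 sqrrN expr1n.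
have [->|->] : p = 2%N \/ p = 3%N.
  by move: pd; rewrite (_ : 6 = 2 * 3)%N // Euclid_dvdM // !dvdn_prime2 // => /orP[]/eqP; [left|right].
- by rewrite z3 eq_sym -addr_eq0 -mulr2n pnatr_eq0.
apply/eqP => z2; have {}z2 : z ^+ 2 = 1 := z2.
have z22 : z = 2 by transitivity (z ^+ 2 + 1 - (z ^+ 2 - z + 1)); [ring | rewrite h z2; ring].
have : 3%:R = 0 :> algC by rewrite -[RHS]h z22; ring.
by move/eqP; rewrite pnatr_eq0.
Qed.

Lemma prim_root3 (z : algC) : z ^+ 2 + z + 1 = 0 -> 3.-primitive_root z.
Proof.
move=> h; apply: primitive_rootP => // [|p pp pd].
  by apply/eqP; rewrite -subr_eq0 -(mulr0 (z - 1)) -h; apply/eqP; ring.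
have -> : p = 3%N by apply/eqP; rewrite -dvdn_prime2.
apply/eqP => z1; have {}z1 : z ^+ 1 = 1 := z1.
have : 3%:R = 0 :> algC by rewrite -[RHS]h -[z]expr1 z1; ring.
by move/eqP; rewrite pnatr_eq0.
Qed.

Lemma prim_root4 (z : algC) : z ^+ 2 + 1 = 0 -> 4.-primitive_root z.
Proof.
move/eqP; rewrite addr_eq0 => /eqP z2; apply: primitive_rootP => // [|p pp pd].
  by rewrite (exprM z 2 2) z2 sqrrN expr1n.
have -> : p = 2%N.
  by apply/eqP; move: pd; rewrite (_ : 4 = 2 ^ 2)%N // (Euclid_dvdX _ _ pp) andbT dvdn_prime2.
by rewrite z2 eq_sym -addr_eq0 -mulr2n pnatr_eq0.
Qed.

Lemma prim_root10 (z : algC) : z ^+ 4 - z ^+ 3 + z ^+ 2 - z + 1 = 0 ->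
  10.-primitive_root z.
Proof.
move=> h; have z5 : z ^+ 5 = -1.
  by apply/eqP; rewrite -subr_eq0 -(mulr0 (z + 1)) -h; apply/eqP; ring.
apply: primitive_rootP => // [|p pp pd].
  by rewrite (exprM z 5 2) z5 sqrrN expr1n.
have [->|->] : p = 2%N \/ p = 5%N.
  by move: pd; rewrite (_ : 10 = 2 * 5)%N // Euclid_dvdM // !dvdn_prime2 // => /orP[]/eqP; [left|right].
- by rewrite z5 eq_sym -addr_eq0 -mulr2n pnatr_eq0.
apply/eqP => z2; have {}z2 : z ^+ 2 = 1 := z2.
have z1 : z = -1 by rewrite -z5 (_ : 5 = 2 * 2 + 1)%N // exprD exprM z2 expr1n mul1r.
have : 5%:R = 0 :> algC by rewrite -[RHS]h z1; ring.
by move/eqP; rewrite pnatr_eq0.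
Qed.

(** * Roots of unity among the roots of D *)

(** Certificates for consequences of polynomial equations: the cofactors are given explicitly and
    [ring] checks the identity. *)
Lemma lincomb (R : comNzRingType) (c x y a b : R) :
  x = y -> a - b = c * (x - y) -> a = b.
Proof. by move=> ->; rewrite subrr mulr0 => /subr0_eq. Qed.

Lemma lincomb2 (R : comNzRingType) (c c' x y x' y' a b : R) :
  x = y -> x' = y' -> a - b = c * (x - y) + c' * (x' - y') -> a = b.
Proof. by move=> -> ->; rewrite !subrr !mulr0 addr0 => /subr0_eq. Qed.

Arguments lincomb {R} c {x y a b}.
Arguments lincomb2 {R} c c' {x y x' y' a b}.

(** The equation reads [z ^ (w + 1) - 1 = k (z ^ w - z)], so [z ^ (w + 1)] is 1 modulo [k]. If it is
    1, then [z ^ w = z] and [z ^ 2 = 1]; if [k = 2] and it is -1, then [z ^ w = z - 1], which is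
    [z ^ 2] for a primitive sixth root [z]. *)
Lemma even_torsion (z : algC) n w k : (0 < n)%N -> z ^+ n = 1 -> (2 <= k)%N ->
  z * (z ^+ w + k%:R) = k%:R * z ^+ w + 1 ->
  [\/ z = 1, z = -1 | k = 2%N /\ (w = 2 %[mod 6])%N].
Proof.
move=> n0 zn k2 e; have Az := Aint_root_of_unity _ _ n0 zn.
have kn0 : k%:R != 0 :> algC by rewrite pnatr_eq0 -lt0n ltnW.
have e1 : z ^+ w.+1 - 1 = k%:R * (z ^+ w - z).
  by rewrite exprS; apply: (lincomb 1 e); ring.
have [||w1|[kE w1]] := Aint_sub1_div_nat (z ^+ w.+1) n k n0 _ k2.
- by rewrite exprAC zn expr1n.
- by rewrite e1 mulrC mulKf // rpredB // rpredX.
- have wz : z ^+ w = z.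
    by apply/eqP; rewrite -subr_eq0; apply/eqP/(mulfI kn0); rewrite -e1 w1 subrr mulr0.
  have zz : z * z = 1 by rewrite -{2}wz -exprS.
  have : (z - 1) * (z + 1) = 0 by apply: (lincomb 1 zz); ring.
  by move/eqP; rewrite mulf_eq0 subr_eq0 addr_eq0 => /orP[]/eqP; [constructor 1 | constructor 2].
- constructor 3; split => //; subst k.
  have wz : z ^+ w = z - 1.
    by apply: (mulfI kn0); apply: (lincomb2 (-1) 1 e1 w1); ring.
  have z2 : z ^+ 2 - z + 1 = 0.
    by move: w1; rewrite exprS wz => w1; apply: (lincomb 1 w1); ring.
  have pr := prim_root6 _ z2; apply/eqP; rewrite -(eq_prim_root_expr pr) wz.
  by apply/eqP; apply: (lincomb (-1) z2); ring.
Qed.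

(* Here [v = z ^+ w], so [v ^+ 2 * z = z ^+ m]: for even [k], [z ^+ m] is 1 modulo 2. *)
Lemma odd_torsion_even_coef (z v : algC) n j : (0 < n)%N -> z ^+ n = 1 ->
  v ^+ n = 1 -> z != 1 -> (0 < j)%N ->
  z * (v ^+ 2 + 2 * v + (j * 2)%:R) = (j * 2)%:R * v ^+ 2 + 2 * v + 1 ->
  [\/ [/\ j = 1%N, z ^+ 2 + z + 1 = 0 & v = z],
      [/\ j = 1%N, z ^+ 4 - z ^+ 3 + z ^+ 2 - z + 1 = 0 & v = z ^+ 2]
    | [/\ j = 2%N, z ^+ 2 - z + 1 = 0 & v = z]].
Proof.
move=> n0 zn vn z1 j0; rewrite natrM => e.
have Az := Aint_root_of_unity _ _ n0 zn; have Av := Aint_root_of_unity _ _ n0 vn.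
have zn0 : z != 0 by apply: contra_eq_neq zn => ->; rewrite expr0n gtn_eqF // eq_sym oner_eq0.
have vn0 : v != 0 by apply: contra_eq_neq vn => ->; rewrite expr0n gtn_eqF // eq_sym oner_eq0.
have jn0 : j%:R != 0 :> algC by rewrite pnatr_eq0 -lt0n.
have z10 : 1 - z != 0 by rewrite subr_eq0 eq_sym.
have n2 : 2%:R != 0 :> algC by rewrite pnatr_eq0.
have eq1 : v ^+ 2 * z - 1 = 2%:R * (j%:R * (v ^+ 2 - z) + v - v * z).
  by apply: (lincomb 1 e); ring.
have [||p1|[_ p1]] := Aint_sub1_div_nat (v ^+ 2 * z) n 2 n0 _ isT.
- by rewrite exprMn exprAC vn zn expr1n mulr1.
- by rewrite eq1 mulrC mulKf // !(rpredB, rpredD, rpredM, rpredX, rpred_nat).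
(* Case [v ^ 2 * z = 1]: here [- v * (1 + z)] inverts [j], so [j = 1]. *)
- have h : j%:R * (1 + z) = - (v * z).
    apply: (mulfI z10); apply: (mulfI n2).
    by apply: (lincomb2 (-z) (z - 2%:R * j%:R) eq1 p1); ring.
  have j1 : j = 1%N.
    apply/eqP; rewrite -dvdn1; apply: nat_inv_Aint => //.
    have -> : 1%:R / j%:R = (1 + z) * (- v).
      apply: (mulIf jn0); rewrite divfK //; apply: (lincomb2 v (-1) h p1); ring.
    by rewrite rpredM ?rpredN ?rpredD.
  constructor 1; subst j; have h1 : 1 + z = - (v * z) by rewrite -h mul1r.
  have h2 : z ^+ 2 + z + 1 = 0.
    by apply: (lincomb2 (1 + z - v * z) z h1 p1); ring.
  by split => //; apply: (mulIf zn0); apply: (lincomb2 1 (-1) h1 h2); ring.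
(* Case [v ^ 2 * z = -1], which eliminates [v] after squaring. *)
have h : v * z * (1 - z) = j%:R * (1 + z ^+ 2) - z.
  apply: (mulfI n2).
  by apply: (lincomb2 (-z) (z - 2%:R * j%:R) eq1 p1); ring.
have h2 : - (z * (1 - z) ^+ 2) = (j%:R * (1 + z ^+ 2) - z) ^+ 2.
  by rewrite -h; apply: (lincomb (- (z * (1 - z) ^+ 2)) p1); ring.
have [j1|j1] := eqVneq j 1%N.
  constructor 2; subst j; rewrite mul1r in h h2.
  have q : z ^+ 4 - z ^+ 3 + z ^+ 2 - z + 1 = 0 by apply: (lincomb (-1) h2); ring.
  split=> //; apply: (mulIf z10); apply: (mulIf zn0).
  by apply: (lincomb2 1 1 h q); ring.
have j2 : (2 <= j)%N by lia.
(* Modulo [j], [h2] says [z (z ^ 2 - z + 1) = 0]; the factor [1 + z] makes this a statement on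
   [z ^ 3]. *)
have h3 : - z ^+ 3 - 1 = j%:R * ((1 + z) * (1 + z ^+ 2) * (z^-1 * j%:R * (1 + z ^+ 2) - 2)).
  apply: (mulfI zn0).
  transitivity ((1 + z) * (z ^+ 2 * 0 + - (z * (1 - z + z ^+ 2)))); first by ring.
  have -> : - (z * (1 - z + z ^+ 2)) = (j%:R * (1 + z ^+ 2) - z) ^+ 2 - z ^+ 2 by rewrite -h2; ring.
  by field.
have Azi : z^-1 \in Aint by apply: (Aint_root_of_unity _ _ n0); rewrite exprVn zn invr1.
have [|||z3|[j2' z3]] := Aint_sub1_div_nat (- z ^+ 3) (2 * n) j _ _ j2.
- by rewrite muln_gt0.
- by rewrite exprM sqrrN exprAC (exprAC z) zn !expr1n.
- by rewrite h3 mulrC mulKf // !(rpredB, rpredD, rpredM, rpredX, rpred_nat).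
(* The root [z = -1] would give [4 = (2 j + 1) ^ 2]; a primitive sixth root gives
   [(j - 1) ^ 2 = 1]. *)
- have : (z + 1) * (z ^+ 2 - z + 1) = 0 by apply: (lincomb (-1) z3); ring.
  move/eqP; rewrite mulf_eq0 addr_eq0 => /orP[/eqP zN1|/eqP z6].
    have : (4%:R : algC) == ((j * 2).+1 ^ 2)%:R.
      have jE : (j * 2).+1%:R = j%:R * 2 + 1 :> algC by rewrite -natr1 natrM.
      by rewrite natrX jE; apply/eqP; apply: (lincomb 1 h2); rewrite zN1; ring.
    by rewrite eqr_nat => /eqP; nia.
  have : (1%:R : algC) == (j.-1 ^ 2)%:R.
    rewrite natrX; apply/eqP/(mulfI zn0)/(mulfI zn0).
    have jE : j%:R = 1 + j.-1%:R :> algC by rewrite -mulrS prednK.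
    set J := j.-1%:R in jE *; rewrite jE in h2.
    apply: (lincomb2 1 (z + (1 + J) * ((1 + J) * (1 + z ^+ 2) + (J - 1) * z)) h2 z6).
    by ring.
  rewrite eqr_nat => /eqP jj; have {jj} jE : j = 2%N by nia.
  constructor 3; split=> //; apply: (mulIf z10); apply: (mulIf zn0).
  by rewrite jE in h; apply: (lincomb2 1 (z + 2) h z6); ring.
(* In the case [j = 2], [z ^ 3 = 1], reducing [h2] modulo [z ^ 2 + z + 1] leaves [6 z ^ 2 = 0]. *)
have : (z - 1) * (z ^+ 2 + z + 1) = 0 by apply: (lincomb (-1) z3); ring.
move/eqP; rewrite mulf_eq0 subr_eq0 (negPf z1) /= => /eqP z33.
have zz : z ^+ 2 = 0; last by move/eqP: zn0; case; apply/eqP; rewrite -sqrf_eq0 zz.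
rewrite j2' in h2; apply: (mulfI (_ : 6%:R != 0)); first by rewrite pnatr_eq0.
by apply: (lincomb2 (-1) (- 4 * z ^+ 2 + 7 * z - 4) h2 z33); ring.
Qed.

(** As [n] is odd, [mu ^ (n + 1) = mu] is a power of [mu ^ 2], so [(mu - 1) / (mu ^ 2 - 1)] is a
    geometric sum in [mu ^ 2]. *)
Lemma Aint_inv_add1_odd_root (mu : algC) n : odd n -> mu ^+ n = 1 -> mu != 1 ->
  (1 + mu)^-1 \in Aint.
Proof.
move=> no mun mu1; have n0 := odd_gt0 no.
have Am := Aint_root_of_unity _ _ n0 mun.
have e : (1 + mu) * \sum_(t < n./2.+1) (mu ^+ 2) ^+ t = 1.
  have mu10 : mu - 1 != 0 by rewrite subr_eq0.
  apply: (mulfI mu10); rewrite mulrA (_ : (mu - 1) * (1 + mu) = mu ^+ 2 - 1); last by ring.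
  rewrite -subrX1 -exprM (_ : 2 * n./2.+1 = n + 1)%N; last by lia.
  by rewrite exprD mun mul1r mulr1.
have : (1 + mu) != 0 by apply: contra_eq_neq e => ->; rewrite mul0r eq_sym oner_eq0.
move=> h; rewrite (_ : _^-1 = \sum_(t < n./2.+1) (mu ^+ 2) ^+ t); last first.
  by apply: (mulfI h); rewrite divff.
by rewrite rpred_sum // => t _; rewrite !rpredX.
Qed.

(* If [4 | ord z], conjugate by [z |-> - z]; otherwise [z ^+ (2 * w)] has odd order, so that
   [1 + z ^+ (2 * w)] is a unit unless it is 2, and the equation is read modulo 2. *)
Lemma odd_torsion_odd_coef (z : algC) n w j : (0 < n)%N -> z ^+ n = 1 -> z != 1 ->
  (0 < j)%N -> let v := z ^+ w in
  z * (v ^+ 2 + 2 * v + (j * 2).+1%:R) = (j * 2).+1%:R * v ^+ 2 + 2 * v + 1 ->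
  [/\ j = 1%N, z ^+ 2 + 1 = 0 & v = z].
Proof.
move=> n0 zn z1 j0 v e; have Az := Aint_root_of_unity _ _ n0 zn.
have Av : v \in Aint by rewrite rpredX.
have n2 : 2%:R != 0 :> algC by rewrite pnatr_eq0.
have [N prN _] := prim_order_exists n0 zn.
have N0 := prim_order_gt0 prN; have zN := prim_expr_order prN.
have zn0 : z != 0 by apply: contra_eq_neq zn => ->; rewrite expr0n gtn_eqF // eq_sym oner_eq0.
set k := (j * 2).+1 in e *.
have k0 : k%:R != 0 :> algC by rewrite pnatr_eq0.
have kn1 : k%:R - 1 != 0 :> algC by rewrite subr_eq0 (eqr_nat _ k 1); lia.
have kn1' : k%:R + 1 != 0 :> algC by rewrite natr1 pnatr_eq0.
have kn3' : k%:R + 3%:R != 0 :> algC by rewrite -natrD pnatr_eq0.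
have vn1 : v <> 1.
  move=> v1; rewrite v1 in e; have : (z - 1) * (k%:R + 3%:R) = 0 by apply: (lincomb 1 e); ring.
  by move/eqP; rewrite mulf_eq0 (negPf kn3') orbF subr_eq0 (negPf z1).
have vnN1 : v <> -1.
  move=> v1; rewrite v1 in e; have : (z - 1) * (k%:R - 1) = 0 by apply: (lincomb 1 e); ring.
  by move/eqP; rewrite mulf_eq0 (negPf kn1) orbF subr_eq0 (negPf z1).
have v2n1 : v ^+ 2 != 1.
  by apply/negP; rewrite sqrf_eq1 => /orP[]/eqP.
have [N4|N4] := boolP (4 %| N)%N.
  have zh : z ^+ (N %/ 2) = -1.
    have : z ^+ (N %/ 2) ^+ 2 = 1 by rewrite -exprM divnK // (dvdn_trans _ N4).
    move/eqP; rewrite sqrf_eq1 => /orP[|/eqP //].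
    have N2 : (2 <= N)%N by rewrite (leq_trans _ (dvdn_leq N0 N4)).
    by rewrite -(prim_order_dvd prN) gtnNdvd // ?divn_gt0 ?ltn_Pdiv.
  (* As 4 divides [N], the exponent [N / 2 + 1] is prime to [N], and the automorphism it defines
     sends [z] to [- z]. *)
  have co : coprime (N %/ 2).+1 N.
    have [q ->] := dvdnP N4; rewrite (_ : 4 = 2 * 2)%N // mulnA mulnK //.
    apply/coprimeP => //; exists ((q * 2).+1, q.+1) => /=.
    rewrite (_ : (q * 2).+1 * (q * 2).+1 = q.+1 * (q * 2 * 2) + 1)%N ?addKn //.
    by clear; nia.
  have [u uE] := Qn_aut_exists co.
  have uz : u z = - z by rewrite uE // exprS zh mulrN1.
  have := congr1 u e; rewrite !(rmorphD, rmorphM, rmorphXn, rmorph1, rmorph_nat) /= uz exprNn.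
  (* For even [w] the automorphism fixes [v], so both [k v ^ 2 + 2 v + 1] and [v ^ 2 + 2 v + k]
     vanish, and [v ^ 2 = 1]. *)
  have [wo|we] := boolP (odd w); last first.
    rewrite -signr_odd (negPf we) expr0 mul1r -/v => e'.
    have a1 : k%:R * v ^+ 2 + 2 * v + 1 = 0.
      by apply: (mulfI n2); apply: (lincomb2 (-1) (-1) e e'); ring.
    have a2 : v ^+ 2 + 2 * v + k%:R = 0.
      by apply: (mulfI zn0); rewrite e a1 mulr0.
    case/eqP: v2n1; apply: (mulfI kn1); apply: (lincomb2 1 (-1) a1 a2); ring.
  (* For odd [w] it negates [v]. Eliminating [z] from [a1] and [a2] gives
     [k (v ^ 4 + k v ^ 2 + 1) = 3 v ^ 2], so [k] divides 3. *)
  rewrite -signr_odd wo expr1 mulN1r -/v => e'.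
  have a1 : 2 * v * z = k%:R * v ^+ 2 + 1.
    by apply: (mulfI n2); apply: (lincomb2 1 1 e e'); ring.
  have a2 : z * (v ^+ 2 + k%:R) = 2 * v.
    by apply: (mulfI n2); apply: (lincomb2 1 (-1) e e'); ring.
  have k3 : k = 3%N.
    have : (k %| 3)%N.
      apply: nat_inv_Aint => //.
      have Av' : v^-1 \in Aint.
        by apply: (Aint_root_of_unity _ _ n0); rewrite exprVn -exprM mulnC exprM zn expr1n invr1.
      have vn0 : v != 0 := expf_neq0 w zn0.
      have -> : 3%:R / k%:R = v^-1 ^+ 2 * (v ^+ 4 + k%:R * v ^+ 2 + 1).
        apply: (mulfI vn0); apply: (mulfI vn0); apply: (mulIf k0).
        transitivity (v ^+ 2 * 3%:R); first by field.
        transitivity (k%:R * (v ^+ 4 + k%:R * v ^+ 2 + 1)); last by field.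
        by apply: (lincomb2 (v ^+ 2 + k%:R) (- 2 * v) a1 a2); ring.
      by rewrite rpredM ?rpredX // !(rpredD, rpredM, rpredX, rpred_nat).
    by move/dvdn_leq => /(_ isT); clear -j0; rewrite /k; lia.
  rewrite k3 in a1 a2.
  have v2 : v ^+ 2 + 1 = 0.
    apply/eqP; rewrite -sqrf_eq0; apply/eqP/(mulfI (_ : 3%:R != 0)); first by rewrite pnatr_eq0.
    by apply: (lincomb2 (-(v ^+ 2 + 3%:R)) (2 * v) a1 a2); ring.
  have vz : v = z.
    by apply: (mulfI n2); apply: (lincomb2 v (3 * v - 2 * z) a1 v2); ring.
  by split; [rewrite /k in k3; clear -k3; lia | rewrite -vz |].
pose N' := if odd N then N else (N %/ 2)%N.
have N'o : odd N' by rewrite /N'; case: ifP => //; clear -N4 N0; lia.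
have vN : (v ^+ 2) ^+ N' = 1.
  have z2N : z ^+ (2 * N') = 1.
    rewrite /N'; case: ifP => oN; first by rewrite mulnC exprM zN expr1n.
    by rewrite (_ : 2 * _ = N)%N //; clear -oN; lia.
  by rewrite -exprM /v exprAC z2N expr1n.
(* Reduction modulo 2: since [1 + v ^ 2] is a unit, 2 divides [z - 1]. *)
have key : (1 + v ^+ 2) * (z - 1) = 2%:R * (- (v * z) - j%:R * z + j%:R * v ^+ 2 + v).
  have kE : k%:R = 1 + 2 * j%:R :> algC by rewrite /k mulrS natrM mulrC.
  by rewrite kE in e; apply: (lincomb 1 e); ring.
have inv := Aint_inv_add1_odd_root _ _ N'o vN v2n1.
have vu : 1 + v ^+ 2 != 0.
  apply/eqP => v0; have v2 : v ^+ 2 = -1 by apply: (lincomb 1 v0); ring.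
  move: vN; rewrite v2 -signr_odd N'o expr1 => /eqP.
  by rewrite eq_sym -addr_eq0 -mulr2n pnatr_eq0.
have [|zz|[_ zz]] := Aint_sub1_div_nat z n 2 n0 zn isT.
- rewrite -[z - 1](mulKf vu) key mulrCA mulrC mulKf // rpredM //.
  by rewrite !(rpredN, rpredB, rpredD, rpredM, rpredX, rpred_nat).
- by rewrite zz eqxx in z1.
- by case/eqP: v2n1; rewrite /v zz -exprM mulnC exprM sqrrN !expr1n.
Qed.

(** * Kronecker's theorem *)

Lemma minCpoly_separable (x : algC) : separable_poly (minCpoly x).
Proof.
have [q [qE monq] qP] := minCpolyP x.
have q0 := monic_neq0 monq.
have sq : (1 < size q)%N by have := size_minCpoly x; rewrite qE size_map_poly.
rewrite qE separable_map.
have q'0 : q^`() != 0.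
  apply/eqP => /(congr1 (fun p : {poly rat} => p`_(size q).-2)); rewrite coef_deriv coef0.
  have -> : (size q).-2.+1 = (size q).-1 by lia.
  by move/eqP; rewrite -lead_coefE (monicP monq) pnatr_eq0; lia.
have gx : ~~ (q %| gcdp q q^`()).
  apply/negP => /dvdp_trans/(_ (dvdp_gcdr _ _))/(dvdp_leq q'0).
  by rewrite leqNgt lt_size_deriv.
apply: dvdp_separable (make_separable q0).
have := root_minCpoly x; rewrite qE -{1}(divpK (dvdp_gcdl q q^`())) rmorphM rootM /=.
by rewrite !qP (negPf gx) orbF.
Qed.

(* The remainder of ['X^n] modulo the integral minimal polynomial is recovered from the
   n-th powers of its roots by inverting a Vandermonde matrix, so its integer coefficients
   are bounded independently of n, and two remainders coincide. *)
Lemma Kronecker_root_of_unity (x : algC) : x \in Aint -> x != 0 ->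
  (forall y, root (minCpoly x) y -> `|y| <= 1) -> exists2 n, (0 < n)%N & x ^+ n = 1.
Proof.
move=> Ax x0 le1.
have /floorpP[p pE] : minCpoly x \is a polyOver Num.int by move: Ax; rewrite unfold_in.
have monp : p \is monic.
  apply/monicP/(@intr_inj algC); rewrite -(lead_coef_map_inj (@intr_inj algC)) //.
  by rewrite -pE (monicP (minCpoly_monic x)).
have [rs rsE] := closed_field_poly_normal (minCpoly x).
rewrite (monicP (minCpoly_monic x)) scale1r in rsE.
have urs : uniq rs by rewrite -separable_prod_XsubC -rsE minCpoly_separable.
set d := size rs.
have rr (j : 'I_d) : root (minCpoly x) rs`_j.
  by rewrite rsE root_prod_XsubC mem_nth.
have szp : size p = d.+1.
  have : size (minCpoly x) = d.+1 by rewrite rsE size_prod_XsubC.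
  by rewrite pE (size_map_inj_poly (@intr_inj algC)).
pose a := \row_(j < d) rs`_j : 'rV[algC]_d.
pose V := Vandermonde d a.
have uV : V \in unitmx.
  rewrite unitmxE unitfE det_Vandermonde prodf_seq_neq0; apply/allP => i _ /=.
  rewrite prodf_seq_neq0; apply/allP => j _; apply/implyP => ij.
  by rewrite !mxE subr_eq0 nth_uniq // gtn_eqF.
(* Division by the monic [p] stays within integer polynomials. *)
pose r n := Pdiv.Ring.rmodp 'X^n p.
pose c n := \row_(i < d) ((r n)`_i)%:~R : 'rV[algC]_d.
have szr n : (size (r n) <= d)%N.
  by rewrite -ltnS -szp Pdiv.Ring.ltn_rmodpN0 // monic_neq0.
have cV n : c n *m V = \row_j rs`_j ^+ n.
  apply/rowP => j; rewrite !mxE.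
  have -> : rs`_j ^+ n = (map_poly intr (r n)).[rs`_j].
    have := congr1 (fun q => (map_poly intr q).[rs`_j]) (Pdiv.RingMonic.rdivp_eq monp 'X^n).
    rewrite rmorphD rmorphM /= hornerD hornerM -pE (eqP (rr j)) mulr0 add0r => <-.
    by rewrite map_polyXn hornerXn.
  rewrite (@horner_coef_wide _ d) ?(size_map_inj_poly (@intr_inj algC)) ?szr //.
  by apply: eq_bigr => i _; rewrite !mxE coef_map.
pose B : algC := \sum_(i < d) \sum_(j < d) `|(invmx V) j i|.
have B0 : 0 <= B by rewrite !sumr_ge0 // => i _; rewrite sumr_ge0.
pose b := Num.bound B.
have cb n (i : 'I_d) : (absz ((r n)`_i)%R <= b)%N.
  rewrite -(ler_nat algC) natr_absz intr_norm.
  have -> : ((r n)`_i)%:~R = \sum_(j < d) rs`_j ^+ n * invmx V j i :> algC.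
    have : c n = \row_(j < d) rs`_j ^+ n *m invmx V by rewrite -cV mulmxK.
    by move/rowP/(_ i); rewrite !mxE => ->; apply: eq_bigr => j _; rewrite !mxE.
  apply: le_trans (ltW (archi_boundP B0)); apply: (le_trans (ler_norm_sum _ _ _)).
  apply: (@le_trans _ _ (\sum_(j < d) `|invmx V j i|)).
    apply: ler_sum => j _; rewrite normrM normrX ler_piMl // exprn_ile1 //; exact: le1.
  by rewrite /B [leRHS](bigD1 i) //= lerDl sumr_ge0 // => k _; rewrite sumr_ge0.
(* Shifting by [b] places the coefficients in [0, ..., 2 b], so the pigeonhole principle applies. *)
pose f n := [ffun i : 'I_d => inord `|(r n)`_i + b%:Z| : 'I_(b + b).+1].
pose K := #|{ffun 'I_d -> 'I_(b + b).+1}|.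
have : ~~ injectiveb (fun n : 'I_K.+1 => f n).
  by apply/injectiveP => /leq_card; rewrite card_ord /K ltnn.
case/injectivePn => n1 [n2 n12 fE].
have cE : c n1 = c n2.
  apply/rowP => i; rewrite !mxE; congr _%:~R.
  have := congr1 val (congr1 (fun g : {ffun _ -> _} => g i) fE).
  have := cb n1 i; have := cb n2 i; rewrite !ffunE /= => h1 h2.
  by rewrite !inordK; lia.
have [jx xE] : exists j : 'I_d, rs`_j = x.
  have : x \in rs by rewrite -root_prod_XsubC -rsE root_minCpoly.
  by case/(nthP 0) => j jd <-; exists (Ordinal jd).
have : c n1 *m V = c n2 *m V by rewrite cE.
rewrite !cV => /rowP/(_ jx); rewrite !mxE xE.
wlog le12 : n1 n2 n12 {fE cE} / (n1 < n2)%N.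
  move=> W e; case: (ltngtP n1 n2) => h; first exact: W h e.
    by apply: W h (esym e); rewrite eq_sym.
  by rewrite (val_inj h) eqxx in n12.
move=> e; exists (n2 - n1)%N; first by rewrite subn_gt0.
apply: (mulfI (expf_neq0 n1 x0)); rewrite -exprD subnKC ?mulr1 //; exact: ltnW.
Qed.

(** * Irreducibility of E and its exceptional factors *)

Definition exceptional (l m : nat) : Prop :=
  (l = 3%N /\ m = 4 %[mod 12]) \/
  (l = 3%N /\ m = 3 %[mod 6]) \/
  (l = 3%N /\ m = 5 %[mod 20]) \/
  (l = 4%N /\ m = 3 %[mod 8]) \/
  (l = 5%N /\ m = 3 %[mod 12]).

Lemma root_Dpoly_neq1 l m : (3 <= l)%N -> (3 <= m)%N -> (4 < (l - 2) * (m - 2))%N ->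
  ~~ root (map_poly intr (Dpoly l m)) (1 : algC).
Proof.
move=> l3 m3 lm; rewrite rootE -[1](rmorph1 (intr : int -> algC)) horner_map /=.
by rewrite intr_eq0 lt_eqF // Dpoly_at1.
Qed.

(** With [k = l - 1], the parities of [m] and [k] select the torsion lemma, and the order of [z]
    yields the residue of [m]. *)
Lemma Dpoly_torsion l m (z : algC) n :
  (3 <= l)%N -> (3 <= m)%N -> (4 < (l - 2) * (m - 2))%N ->
  (0 < n)%N -> z ^+ n = 1 -> root (map_poly intr (Dpoly l m)) z ->
  (z = -1 /\ (m %% 4 = 2)%N) \/ exceptional l m.
Proof.
move=> l3 m3 lm n0 zn rz; have m2 := ltnW m3.
have z1 : z != 1 by apply: contraTneq rz => ->; exact: root_Dpoly_neq1.
have [k lE] : exists k, l = k.+1 by exists l.-1; lia.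
have := root_Dpoly_eq _ _ _ _ m2 rz.
rewrite lE -natr1 addrK /=.
case: ifP => om e; last first.
  have [zz|zz|[kE wE]] := even_torsion z n m./2 k n0 zn (ltac:(lia)) e.
  - by rewrite zz eqxx in z1.
  (* With [m./2] even, [z = -1] would give [2 (k + 1) = 0]. *)
  - left; split=> //; have [ow|ew] := boolP (odd m./2); first lia.
    move: e; rewrite zz -signr_odd (negPf ew) expr0 => e.
    have : (k.+1)%:R = 0 :> algC.
      by apply: (mulfI (_ : 2%:R != 0)); rewrite ?pnatr_eq0 // -natr1; apply: (lincomb (-1) e); ring.
    by move/eqP; rewrite pnatr_eq0.
  - by right; left; lia.
right; set v := z ^+ m./2 in e.
have vn : v ^+ n = 1 by rewrite exprAC zn expr1n.
have [ok|ek] := boolP (odd k); last first.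
  have [j kE] : exists j, k = (j * 2)%N by exists k./2; lia.
  rewrite kE in e; have [[j1 zz vz]|[j1 zz vz]|[j1 zz vz]] :=
    odd_torsion_even_coef z v n j n0 zn vn z1 (ltac:(lia)) e.
  - have := eq_prim_root_expr (prim_root3 _ zz) m./2 1; rewrite expr1 -/v vz eqxx => /esym/eqP.
    by right; left; lia.
  - have := eq_prim_root_expr (prim_root10 _ zz) m./2 2; rewrite -/v vz eqxx => /esym/eqP.
    by right; right; left; lia.
  - have := eq_prim_root_expr (prim_root6 _ zz) m./2 1; rewrite expr1 -/v vz eqxx => /esym/eqP.
    by do 4 right; lia.
have [j kE] : exists j, k = (j * 2).+1 by exists k./2; lia.
rewrite kE in e.
have [j1 zz vz] := odd_torsion_odd_coef z n m./2 j n0 zn z1 (ltac:(lia)) e.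
have := eq_prim_root_expr (prim_root4 _ zz) m./2 1; rewrite expr1 vz eqxx => /esym/eqP.
by do 3 right; left; lia.
Qed.

(** As [m./2] is odd, [X M(v) - N(v)] vanishes at -1. Its derivative there is
    [k - 1 - (k + 1) m./2 < 0], so the root is simple. *)
Lemma Dpoly_factor_Xadd1 l m : (3 <= l)%N -> (3 <= m)%N -> (m %% 4 = 2)%N ->
  exists2 q : {poly int}, Dpoly l m = q * ('X + 1) & q.[-1] != 0.
Proof.
move=> l3 m3 m42; have m2 := ltnW m3.
have om : odd m = false by clear -m42; lia.
have ow : odd m./2 by clear -m42; lia.
have eX : 'X + 1 = 'X - (-1)%:P :> {poly int} by rewrite polyCN opprK.
have := mul_Dpoly l m m2; rewrite /= om; set k := l%:Z - 1 => e.
have vN1 : 'X^(m./2).[-1] = -1 :> int by rewrite hornerXn -signr_odd ow expr1.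
have dvN1 : ('X^(m./2))^`().[-1] = (m./2)%:R :> int.
  rewrite derivXn hornerMn hornerXn -signr_odd (_ : odd (m./2).-1 = false) ?expr0 //.
  by clear -ow; lia.
have : root (Dpoly l m) (-1).
  have := congr1 (fun p => p.[-1]) e; rewrite !(hornerM, hornerD, hornerN, hornerX, hornerC) vN1.
  move=> h; rewrite rootE; have : 2 * (Dpoly l m).[-1] = 0 by apply: (lincomb (-1) h); ring.
  by clear; lia.
case/factor_theorem => q Dq; exists q; first by rewrite eX.
apply/eqP => q0; have := congr1 (fun p => (p^`()).[-1]) e.
rewrite Dq !(derivM, derivD, derivN, derivX, derivC) !(hornerM, hornerD, hornerN, hornerX, hornerC).
rewrite q0 vN1 dvN1 /k => h; have : (0 < m./2)%N by clear -m3; lia.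
by clear -h l3; nia.
Qed.

(** An integral model of E for work in [algC]: passing from D to it loses at most the root -1. *)
Lemma Epoly_intP l m : (3 <= l)%N -> (3 <= m)%N -> exists e c : {poly int},
  [/\ Epoly l m = map_poly intr e, e \is monic, Dpoly l m = e * c,
      forall z : algC, z != -1 -> root (map_poly intr (Dpoly l m)) z -> root (map_poly intr e) z
    & (m %% 4 = 2)%N -> ~~ root (map_poly intr e) (-1 : algC)].
Proof.
move=> l3 m3; have m2 := ltnW m3.
rewrite /Epoly; case: eqP => m42; last first.
  by exists (Dpoly l m), 1; rewrite mulr1; split=> //; exact: Dpoly_monic.
have [q Dq q1] := Dpoly_factor_Xadd1 l m l3 m3 m42.
have eX (R : nzRingType) : 'X + 1 = 'X - (-1)%:P :> {poly R} by rewrite polyCN opprK.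
exists q, ('X + 1); split=> //.
- by rewrite Dq rmorphM rmorphD /= map_polyX rmorph1 mulpK // eX polyXsubC_eq0.
- by move: (Dpoly_monic l m m2); rewrite Dq monicMr // eX monicXsubC.
- move=> z zn1; rewrite Dq rmorphM rootM rmorphD /= map_polyX rmorph1 => /orP[//|].
  by rewrite eX root_XsubC (negPf zn1).
- by move=> _; rewrite rootE -[-1](rmorphN1 (intr : int -> algC)) horner_map /= intr_eq0.
Qed.

(** Of two complementary factors, one avoids the simple root [lam]. By Kronecker's theorem its roots
    are roots of unity, and [Dpoly_torsion] excludes them all, so it is constant. *)
Lemma Epoly_irreducible l m : (3 <= l)%N -> (3 <= m)%N -> (4 < (l - 2) * (m - 2))%N ->
  ~ exceptional l m -> irreducible_poly (Epoly l m).
Proof.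
move=> l3 m3 lm nex; have m2 := ltnW m3.
have [e [c [eE mone Dec De eN1]]] := Epoly_intP l m l3 m3.
have [_ [lam [rlam lam1 slam ulam]]] := Dpoly_salem l m l3 m3 lm.
set E := Epoly l m in eE *.
have ratE : map_poly (ratr : rat -> algC) E = map_poly intr e.
  by rewrite eE -map_poly_comp; apply: eq_map_poly => x /=; rewrite ratr_int.
have lamE : root (map_poly ratr E) lam.
  by rewrite ratE; apply: De rlam; apply: contraTneq lam1 => ->; rewrite normrN1 ltxx.
have monE : E \is monic by rewrite eE monic_map.
have E0 := monic_neq0 monE.
have ED (z : algC) : root (map_poly ratr E) z -> root (map_poly intr (Dpoly l m)) z.
  by rewrite ratE Dec rmorphM rootM => ->.
have not_lam (p : {poly rat}) : p %| E -> ~~ root (map_poly ratr p) lam -> size p = 1%N.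
  move=> pE nlam; have p0 : p != 0 by apply: contraTneq pE => ->; rewrite dvd0p.
  have rE (y : algC) : root (map_poly ratr p) y -> root (map_poly ratr E) y.
    by move=> py; rewrite -(divpK pE) rmorphM rootM py orbT.
  apply/eqP; rewrite -(size_map_poly (ratr : rat -> algC)); apply/negP => /negP.
  case/closed_rootP => z pz; have rDz := ED _ (rE _ pz).
  have Az : z \in Aint.
    apply: root_monic_Aint rDz _ _; first by rewrite monic_map ?Dpoly_monic.
    by apply/polyOverP => i; rewrite coef_map rpred_int.
  have z0 : z != 0.
    apply: contraTneq rDz => ->; rewrite rootE -[0](rmorph0 (intr : int -> algC)).
    rewrite horner_map /= intr_eq0 horner_coef0 coef_poly /Dcoef.
    by rewrite ltnS.
  have [n n0 zn] : exists2 n, (0 < n)%N & z ^+ n = 1.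
    apply: Kronecker_root_of_unity => // y.
    (* The conjugates of [z] are roots of [p] too, hence differ from [lam]. *)
    have [q [-> _] qP] := minCpolyP z; have := pz; rewrite qP => qp qy.
    have py : root (map_poly ratr p) y by rewrite -(divpK qp) rmorphM rootM qy orbT.
    rewrite real_leNgt ?rpred1 ?normr_real //; apply/negP => y1.
    by move: nlam; rewrite -(ulam y (ED _ (rE _ py)) y1) py.
  have [[zN m42]|//] := Dpoly_torsion l m z n l3 m3 lm n0 zn rDz.
  by have := eN1 m42; rewrite -zN -ratE rE.
split.
  by rewrite -(size_map_poly (ratr : rat -> algC)) (root_size_gt1 _ lamE) // map_poly_eq0.
move=> q q1 qE; have [ql|ql] := boolP (root (map_poly ratr q) lam); last first.
  by rewrite (not_lam q qE ql) eqxx in q1.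
have Eq := divpK qE.
have s1 : size (E %/ q) = 1%N.
  apply: not_lam; first by rewrite -{2}Eq dvdp_mulr.
  (* If both factors vanished at [lam], its linear factor would divide D twice. *)
  apply: contraNN slam => rl; rewrite Dec rmorphM /= -ratE -Eq rmorphM /= expr2.
  by rewrite dvdp_mulr // dvdp_mul // dvdp_XsubCl.
have [a a0 aE] := size_poly1P _ (introT eqP s1).
by apply/eqpP; exists (a, 1); rewrite ?oner_eq0 ?a0 //= scale1r -Eq aE mul_polyC.
Qed.

(* Modulo [f * ('X - 1)], the polynomial ['X ^ (m./2)] depends only on [m./2 %% N]. *)
Lemma dvdp_Epoly l m (f g : {poly rat}) N r :
  (2 <= m)%N -> (m %% 4)%N != 2%N -> (m./2 %% N = r)%N ->
  'X^N - 1 = f * ('X - 1) * g ->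
  (let k := (l%:R - 1)%:P in
   (if odd m then 'X^r ^+ 2 * ('X - k) + 2 * 'X^r * ('X - 1) + (k * 'X - 1)
    else 'X^r * ('X - k) + (k * 'X - 1)) = f * ('X - 1)) ->
  f %| Epoly l m.
Proof.
move=> m2 m42 wr gE; rewrite /Epoly (negPf m42) /=.
have [h hE] : exists h, 'X^(m./2) - 'X^r = f * ('X - 1) * h :> {poly rat}.
  exists (g * 'X^r * \sum_(i < m./2 %/ N) ('X^N) ^+ i).
  rewrite {1}(divn_eq m./2 N) wr exprD mulnC exprM -{2}['X^r]mul1r -mulrBl subrX1 gE.
  by ring.
have := congr1 (map_poly (intr : int -> rat)) (mul_Dpoly l m m2) => /=.
have kE : map_poly intr (l%:Z - 1)%:P = (l%:R - 1)%:P :> {poly rat}.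
  by rewrite map_polyC /= rmorphB rmorph1.
rewrite rmorphM rmorphB /= map_polyX rmorph1; move: kE.
generalize (l%:Z - 1)%:P => kz; set k := (l%:R - 1)%:P => kE.
have X1 : 'X - 1 != 0 :> {poly rat} by rewrite polyXsubC_eq0.
have VE : 'X^(m./2) = 'X^r + f * ('X - 1) * h :> {poly rat} by rewrite -hE addrC subrK.
case: ifP => om e fE.
  move: e; rewrite !(rmorphD, rmorphN, rmorphM, rmorphXn, rmorph1) /= kE !map_polyX VE => e.
  apply/dvdpP; exists (1 + h * ((2 * 'X^r + f * ('X - 1) * h) * ('X - k) + 2 * ('X - 1))).
  by apply: (mulfI X1); apply: (lincomb2 1 1 e fE); ring.
move: e; rewrite !(rmorphD, rmorphN, rmorphM, rmorphXn, rmorph1) /= kE !map_polyX VE => e.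
apply/dvdpP; exists (1 + h * ('X - k)).
by apply: (mulfI X1); apply: (lincomb2 1 1 e fE); ring.
Qed.

(** In each case the factor is cyclotomic, of index 6, 3, 10, 4, 6 in turn, taken as [N]; [g]
    collects the remaining factors of ['X^N - 1], and the residue of [m] fixes [r]. *)
Lemma Epoly_factors l m : (3 <= m)%N ->
  [/\ l = 3%N -> m = 4 %[mod 12] -> ('X^2 - 'X + 1) %| Epoly l m,
      l = 3%N -> m = 3 %[mod 6] -> ('X^2 + 'X + 1) %| Epoly l m,
      l = 3%N -> m = 5 %[mod 20] -> ('X^4 - 'X^3 + 'X^2 - 'X + 1) %| Epoly l m,
      l = 4%N -> m = 3 %[mod 8] -> ('X^2 + 1) %| Epoly l m
    & l = 5%N -> m = 3 %[mod 12] -> ('X^2 - 'X + 1) %| Epoly l m].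
Proof.
move=> m3; have m2 := ltnW m3.
have kE n : (n.+1%:R - 1)%:P = n%:R :> {poly rat} by rewrite -natr1 addrK polyC_natr.
split=> -> mm.
- apply: (@dvdp_Epoly _ _ _ (('X + 1) * ('X^2 + 'X + 1)) 6 2) => //; try (clear -mm; lia).
    by ring.
  by rewrite kE /= (_ : odd m = false); [ring | clear -mm; lia].
- apply: (@dvdp_Epoly _ _ _ 1 3 1) => //; try (clear -mm; lia); first by ring.
  by rewrite kE /= (_ : odd m = true); [ring | clear -mm; lia].
- apply: (@dvdp_Epoly _ _ _ (('X + 1) * ('X^4 + 'X^3 + 'X^2 + 'X + 1)) 10 2) => //; try (clear -mm; lia).
    by ring.
  by rewrite kE /= (_ : odd m = true); [ring | clear -mm; lia].
- apply: (@dvdp_Epoly _ _ _ ('X + 1) 4 1) => //; try (clear -mm; lia); first by ring.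
  by rewrite kE /= (_ : odd m = true); [ring | clear -mm; lia].
- apply: (@dvdp_Epoly _ _ _ (('X + 1) * ('X^2 + 'X + 1)) 6 1) => //; try (clear -mm; lia).
    by ring.
  by rewrite kE /= (_ : odd m = true); [ring | clear -mm; lia].
Qed.

Theorem theorem1 (l m : nat) :
  (3 <= l)%N -> (3 <= m)%N -> (4 < (l - 2) * (m - 2))%N ->
  (reciprocal (Dpoly l m) /\ salem_poly (Dpoly l m)) /\
  ((~ ((l = 3%N /\ m = 4 %[mod 12]) \/
          (l = 3%N /\ m = 3 %[mod 6]) \/
          (l = 3%N /\ m = 5 %[mod 20]) \/
          (l = 4%N /\ m = 3 %[mod 8]) \/
          (l = 5%N /\ m = 3 %[mod 12]))) ->
     irreducible_poly (Epoly l m)) /\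
  (l = 3%N -> m = 4 %[mod 12] -> ('X^2 - 'X + 1) %| Epoly l m) /\
  (l = 3%N -> m = 3 %[mod 6] -> ('X^2 + 'X + 1) %| Epoly l m) /\
  (l = 3%N -> m = 5 %[mod 20] ->
     ('X^4 - 'X^3 + 'X^2 - 'X + 1) %| Epoly l m) /\
  (l = 4%N -> m = 3 %[mod 8] -> ('X^2 + 1) %| Epoly l m) /\
  (l = 5%N -> m = 3 %[mod 12] -> ('X^2 - 'X + 1) %| Epoly l m).
Proof.
move=> l3 m3 lm; have [f1 f2 f3 f4 f5] := Epoly_factors l m m3.
split; first by split; [exact/Dpoly_reciprocal/ltnW | exact: Dpoly_salem].
by split; first exact: Epoly_irreducible.
Qed.
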